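(* If $n\ge3$ is an integer and $\gamma>1$ is real, then $$\gamma^{\frac{3}{8n-4}}<\varrho_0(\gamma,n)<\gamma^{\frac{1}{2n}}.$$ Moreover, for each integer $n\ge3$, $$\lim_{\gamma\to1^+}\frac{\log\varrho_0(\gamma,n)}{\log\gamma}=\frac{3}{8n-4}\qquad\text{and}\qquad\lim_{\gamma\to\infty}\frac{\log\varrho_0(\gamma,n)}{\log\gamma}=\frac{1}{2n}.$$
   Context: For $\alpha,\beta>0$ and an integer $n\ge2$, the function $$f_{\alpha,\beta,n}(\varrho)=\alpha+\beta+\sum_{i=1}^{n-1}\left(\alpha\varrho^{-2i}+\beta\varrho^{2i}\right),\qquad\varrho>0,$$ attains its minimum over $\varrho>0$ at a unique point, which depends only on $\alpha/\beta$ and $n$ and is denoted $\varrho_0(\alpha/\beta,n)$. Thus for $\gamma>0$, $\varrho_0(\gamma,n)$ is the unique minimizer over $\varrho>0$ of $\sum_{i=1}^{n-1}\left(\gamma\varrho^{-2i}+\varrho^{2i}\right)$. *)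

(* Defs.v *)
From Stdlib Require Import Reals Lra Lia ClassicalEpsilon.
From Coquelicot Require Import Coquelicot.
Open Scope R_scope.

Definition f (alpha beta : R) (n : nat) (rho : R) : R :=
  alpha + beta
  + sum_n_m (fun i : nat => alpha / rho ^ (2 * i) + beta * rho ^ (2 * i)) 1 (n - 1).

Definition is_minimizer_pos (g : R -> R) (r : R) : Prop :=
  0 < r /\ forall s : R, 0 < s -> g r <= g s.

(* The choice is harmless for [0 < gamma] and [2 <= n]: by [rho0_minimizes] and
   [rho0_unique], for all [alpha, beta > 0] the point [rho0 (alpha / beta) n] is
   the only minimizer of [f alpha beta n] over the positive reals. *)
Definition rho0 (gamma : R) (n : nat) : R :=
  epsilon (inhabits 0) (is_minimizer_pos (f gamma 1 n)).

Lemma f_scale (alpha beta : R) (n : nat) (r : R) :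
  0 < beta -> f alpha beta n r = beta * f (alpha / beta) 1 n r.
Proof.
intros Hb. unfold f.
rewrite !Rmult_plus_distr_l.
change (beta * sum_n_m ?u ?a ?b) with (mult beta (sum_n_m u a b)).
rewrite <- (sum_n_m_mult_l (K := R_Ring)).
f_equal.
- field; lra.
- apply sum_n_m_ext. intros i. unfold mult; simpl mult; cbn -[pow Nat.mul].
  unfold Rdiv. rewrite Rmult_plus_distr_l, Rmult_1_l, <- !Rmult_assoc.
  f_equal. f_equal. field; lra.
Qed.

Lemma minimizer_scale (alpha beta : R) (n : nat) (r : R) :
  0 < beta ->
  is_minimizer_pos (f alpha beta n) r <-> is_minimizer_pos (f (alpha / beta) 1 n) r.
Proof.
intros Hb; split; intros [Hr H]; split; try exact Hr; intros s Hs;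
  specialize (H s Hs); rewrite !(f_scale alpha beta n) in * by exact Hb.
- now apply Rmult_le_reg_l in H.
- apply Rmult_le_compat_l; lra.
Qed.

Lemma sum_n_m_ge0 (u : nat -> R) (a b : nat) :
  (forall i, 0 <= u i) -> 0 <= sum_n_m u a b.
Proof.
intros H. replace 0 with (sum_n_m (fun _ => 0) a b)
  by (rewrite sum_n_m_const; apply Rmult_0_r).
apply sum_n_m_le. intros i. apply H.
Qed.

Lemma f_lower (alpha beta : R) (n : nat) (r : R) :
  0 < alpha -> 0 < beta -> (2 <= n)%nat -> 0 < r ->
  alpha / r ^ 2 + beta * r ^ 2 < f alpha beta n r.
Proof.
intros Ha Hb Hn Hr. unfold f.
rewrite (sum_Sn_m (G := R_AbelianMonoid)) by lia.
change (plus ?x ?y) with (x + y).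
match goal with |- context [sum_n_m ?u 2 ?b] =>
  assert (H : 0 <= sum_n_m u 2 b) end.
{ apply sum_n_m_ge0. intros i.
  assert (Hp : 0 < r ^ (2 * i)) by now apply pow_lt.
  assert (0 < alpha / r ^ (2 * i)) by now apply Rdiv_lt_0_compat.
  assert (0 < beta * r ^ (2 * i)) by now apply Rmult_lt_0_compat.
  lra. }
change (2 * 1)%nat with 2%nat. lra.
Qed.

Lemma f_continuous (alpha beta : R) (n : nat) (r : R) :
  0 < r -> continuity_pt (f alpha beta n) r.
Proof.
intros Hr. apply continuity_pt_filterlim. change (continuous (fun x => plus (alpha + beta)
  (sum_n_m (fun i => alpha / x ^ (2 * i) + beta * x ^ (2 * i)) 1 (n - 1))) r).
apply (continuous_plus (fun _ => alpha + beta)); [apply continuous_const|].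
induction (n - 1)%nat as [|k IH].
- apply continuous_ext with (fun _ => 0).
  + intros x. now rewrite sum_n_m_zero by lia.
  + apply continuous_const.
- apply continuous_ext with (fun x => plus
    (sum_n_m (fun i => alpha / x ^ (2 * i) + beta * x ^ (2 * i)) 1 k)
    (alpha / x ^ (2 * S k) + beta * x ^ (2 * S k))).
  + intros x. now rewrite sum_n_Sm by lia.
  + apply (continuous_plus (V := R_NormedModule) (fun x =>
      sum_n_m (fun i => alpha / x ^ (2 * i) + beta * x ^ (2 * i)) 1 k)
      (fun x => alpha / x ^ (2 * S k) + beta * x ^ (2 * S k))); [exact IH|].
    apply (ex_derive_continuous (V := R_NormedModule)). auto_derive.
    apply Rgt_not_eq. apply (pow_lt r (2 * S k) Hr).
Qed.

Lemma minimizer_exists (alpha beta : R) (n : nat) :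
  0 < alpha -> 0 < beta -> (2 <= n)%nat ->
  exists r, is_minimizer_pos (f alpha beta n) r.
Proof.
intros Ha Hb Hn.
set (M := f alpha beta n 1).
assert (HM : 0 < M).
{ pose proof (f_lower alpha beta n 1 Ha Hb Hn Rlt_0_1).
  unfold M. rewrite pow1 in H. lra. }
set (b := 1 + M / beta). set (A := 1 + M / alpha).
assert (HMb : 0 < M / beta) by now apply Rdiv_lt_0_compat.
assert (HMa : 0 < M / alpha) by now apply Rdiv_lt_0_compat.
assert (HA : 0 < / A) by (apply Rinv_0_lt_compat; unfold A; lra).
assert (HA1 : / A <= 1).
{ rewrite <- Rinv_1. apply Rinv_le_contravar; unfold A; lra. }
destruct (continuity_ab_min (f alpha beta n) (/ A) b) as [m [Hm Hmab]].
- unfold b; lra.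
- intros c Hc. apply f_continuous. lra.
- exists m. split; [lra|]. intros s Hs.
  assert (H1 : f alpha beta n m <= M) by (apply Hm; unfold b; lra).
  destruct (Rlt_le_dec s (/ A)) as [Hs1|Hs1];
    [|destruct (Rlt_le_dec b s) as [Hs2|Hs2]; [|now apply Hm]].
  + pose proof (f_lower alpha beta n s Ha Hb Hn Hs) as H.
    assert (Ht : A < / s).
    { rewrite <- (Rinv_inv A). apply Rinv_lt_contravar; [|exact Hs1].
      now apply Rmult_lt_0_compat. }
    assert (0 < beta * s ^ 2) by (apply Rmult_lt_0_compat; [|apply pow_lt]; lra).
    unfold Rdiv at 1 in H. rewrite <- pow_inv in H.
    set (t := / s) in *.
    assert (M < alpha * t).
    { replace M with (alpha * (M / alpha)) by (field; lra).
      apply Rmult_lt_compat_l; unfold A in Ht; lra. }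
    assert (alpha * t <= alpha * t ^ 2).
    { apply Rmult_le_compat_l; [lra|]. unfold A in Ht. nra. }
    lra.
  + pose proof (f_lower alpha beta n s Ha Hb Hn Hs) as H.
    assert (0 < alpha / s ^ 2) by (apply Rdiv_lt_0_compat; [|apply pow_lt]; lra).
    assert (M < beta * s).
    { replace M with (beta * (M / beta)) by (field; lra).
      apply Rmult_lt_compat_l; unfold b in Hs2; lra. }
    assert (beta * s <= beta * s ^ 2).
    { apply Rmult_le_compat_l; [lra|]. unfold b in Hs2. nra. }
    lra.
Qed.

(* Strict convexity in [ln rho], stated at the geometric mean. *)
Lemma f_midpoint (alpha beta : R) (n : nat) (r s : R) :
  0 < alpha -> 0 < beta -> (2 <= n)%nat -> 0 < r -> 0 < s -> r <> s ->
  2 * f alpha beta n (sqrt (r * s)) < f alpha beta n r + f alpha beta n s.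
Proof.
intros Ha Hb Hn Hr Hs Hrs. unfold f.
set (m := sqrt (r * s)).
assert (Hm2 : m ^ 2 = r * s) by (apply pow2_sqrt; nra).
set (T := fun (x : R) (i : nat) => alpha / x ^ (2 * i) + beta * x ^ (2 * i)).
assert (HT : forall i, T r i + T s i - 2 * T m i =
  alpha * (/ r ^ i - / s ^ i) ^ 2 + beta * (r ^ i - s ^ i) ^ 2).
{ intros i. unfold T. rewrite (pow_mult m), Hm2, Rpow_mult_distr.
  rewrite !(Nat.mul_comm 2 i), !pow_mult.
  assert (r ^ i <> 0) by (apply Rgt_not_eq; now apply pow_lt).
  assert (s ^ i <> 0) by (apply Rgt_not_eq; now apply pow_lt).
  field; auto. }
assert (Hle : forall i, 2 * T m i <= T r i + T s i).
{ intros i. specialize (HT i).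
  assert (0 <= alpha * (/ r ^ i - / s ^ i) ^ 2)
    by (apply Rmult_le_pos; [lra|apply pow2_ge_0]).
  assert (0 <= beta * (r ^ i - s ^ i) ^ 2)
    by (apply Rmult_le_pos; [lra|apply pow2_ge_0]).
  lra. }
assert (Hlt : 2 * T m 1%nat < T r 1%nat + T s 1%nat).
{ specialize (HT 1%nat). rewrite !pow_1 in HT.
  assert (0 <= alpha * (/ r - / s) ^ 2)
    by (apply Rmult_le_pos; [lra|apply pow2_ge_0]).
  assert (0 < beta * (r - s) ^ 2).
  { apply Rmult_lt_0_compat; [lra|]. apply pow2_gt_0. lra. }
  lra. }
assert (Hsum : 2 * sum_n_m (T m) 2 (n - 1)
               <= sum_n_m (T r) 2 (n - 1) + sum_n_m (T s) 2 (n - 1)).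
{ change (2 * sum_n_m ?u ?a ?b) with (mult 2 (sum_n_m u a b)).
  rewrite <- (sum_n_m_mult_l (K := R_Ring)).
  change (?x + ?y) with (plus x y).
  rewrite <- (sum_n_m_plus (G := R_AbelianMonoid)).
  apply sum_n_m_le. exact Hle. }
fold (T r) (T s) (T m).
rewrite !(sum_Sn_m (G := R_AbelianMonoid) _ 1) by lia.
change (@plus ?G ?x ?y) with (x + y).
lra.
Qed.

Lemma minimizer_unique (alpha beta : R) (n : nat) (r s : R) :
  0 < alpha -> 0 < beta -> (2 <= n)%nat ->
  is_minimizer_pos (f alpha beta n) r -> is_minimizer_pos (f alpha beta n) s -> r = s.
Proof.
intros Ha Hb Hn [Hr Hr'] [Hs Hs'].
destruct (Req_dec r s) as [|Hrs]; [assumption|exfalso].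
pose proof (f_midpoint alpha beta n r s Ha Hb Hn Hr Hs Hrs).
assert (Hm : 0 < sqrt (r * s)) by (apply sqrt_lt_R0; nra).
specialize (Hr' _ Hm). specialize (Hs' _ Hm). lra.
Qed.

Lemma rho0_minimizes (alpha beta : R) (n : nat) :
  0 < alpha -> 0 < beta -> (2 <= n)%nat ->
  is_minimizer_pos (f alpha beta n) (rho0 (alpha / beta) n).
Proof.
intros Ha Hb Hn. apply minimizer_scale; [exact Hb|].
unfold rho0. apply epsilon_spec, minimizer_exists; [|lra|exact Hn].
now apply Rdiv_lt_0_compat.
Qed.

Lemma rho0_unique (alpha beta : R) (n : nat) (r : R) :
  0 < alpha -> 0 < beta -> (2 <= n)%nat ->
  is_minimizer_pos (f alpha beta n) r -> r = rho0 (alpha / beta) n.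
Proof.
intros Ha Hb Hn Hr. apply (minimizer_unique alpha beta n); auto.
now apply rho0_minimizes.
Qed.

(* Main.v *)
Require Import Defs.
From Stdlib Require Import Reals Lra Lia.
From Coquelicot Require Import Coquelicot.
Open Scope R_scope.

(** Put [t = 2 ln rho0] and [a(t) = sum_{i=1}^{n-1} i e^(i t)].  Vanishing of the
    derivative of [f] at the minimizer reads [a(t) = gamma a(-t)], that is
    [ln gamma = L(t)] with [L(t) = ln a(t) - ln a(-t)] ([ln_gamma_eq]), and
    [gamma > 1] forces [t > 0].  Since [ln rho0 / ln gamma = t / (2 L(t))], every
    claim is a claim about the explicit function [L]: the two inequalities say
    that [n t < L(t) < 2 (2n-1)/3 t] for [t > 0] ([logratio_bounds]), and the two
    limits are those of [L(t) / t] at [0] and at infinity.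

    For the inequalities, the arithmetico-geometric sum has the closed form
      [(e^t - 2 + e^-t) a(t) = 1 - n e^((n-1) t) + (n-1) e^(n t)],
    whose factor on the left is even and positive, so that it cancels when [a(t)]
    is compared with a multiple of [a(-t)].  After symmetrizing the exponents, the
    lower bound on [L] becomes
      [n sinh((n-2) t/2) < (n-2) sinh(n t/2)],
    the monotonicity of [sinh v / v], and the upper bound becomes the positivity of
      [G(u) = sinh((2n-1) u) - (n-1) sinh((n+1) u) + n sinh((n-2) u)], [u = t/3].
    Here [G(0) = G'(0) = 0], and [G'' - (n-2)^2 G] is again, up to a positive
    factor, a difference controlled by the monotonicity of [sinh v / v];
    factoring the operator as [(D - (n-2)) (D + (n-2))] yields [G > 0]
    ([sinh_three_term_pos]).

    The limit at [1] holds because [L'(0) = 2 a'(0) / a(0) = 2 (2n-1)/3], a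
    quotient of a sum of squares by a sum of integers, and [t] tends to [0] with
    [ln gamma].  The limit at infinity holds because
    [a(t) <= a(0) e^((n-1) t)] and [a(-t) >= e^-t] give [L(t) <= n t + ln a(0)],
    which squeezes [ln rho0 / ln gamma] between [1/(2n) - O(1 / ln gamma)] and
    [1/(2n)]. *)

(** * Hyperbolic inequalities *)

Lemma pos_of_deriv_pos (F F' : R -> R) :
  F 0 = 0 ->
  (forall x, is_derive F x (F' x)) ->
  (forall x, 0 < x -> 0 < F' x) ->
  forall x, 0 < x -> 0 < F x.
Proof.
intros F0 HF HF' x Hx.
destruct (MVT_cor2 F F' 0 x Hx) as [c [Hc Hc0]].
- intros c _. apply is_derive_Reals, HF.
- specialize (HF' c ltac:(lra)). rewrite F0 in Hc. nra.
Qed.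

Lemma cosh_scale_lt (a b v : R) :
  0 < b < a -> 0 < v -> cosh (b * v) < cosh (a * v).
Proof.
intros Hab Hv. apply Rminus_lt_0. revert v Hv.
apply (pos_of_deriv_pos (fun v => cosh (a * v) - cosh (b * v))
         (fun v => a * sinh (a * v) - b * sinh (b * v))).
- rewrite !Rmult_0_r. ring.
- intros v. auto_derive; [easy|ring].
- intros v Hv.
  assert (H1 : sinh (b * v) < sinh (a * v)) by (apply sinh_lt; nra).
  assert (H0 : sinh 0 < sinh (b * v)) by (apply sinh_lt; nra).
  rewrite sinh_0 in H0. nra.
Qed.

(** The map [v -> sinh v / v] is increasing, in a form without division. *)
Lemma sinh_ratio_lt (a b v : R) :
  0 < b < a -> 0 < v -> a * sinh (b * v) < b * sinh (a * v).
Proof.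
intros Hab Hv. apply Rminus_lt_0. revert v Hv.
apply (pos_of_deriv_pos (fun v => b * sinh (a * v) - a * sinh (b * v))
         (fun v => a * b * (cosh (a * v) - cosh (b * v)))).
- rewrite !Rmult_0_r, sinh_0. ring.
- intros v. auto_derive; [easy|ring].
- intros v Hv. pose proof (cosh_scale_lt a b v Hab Hv).
  apply Rmult_lt_0_compat; nra.
Qed.

(** With [A = 2m-1], [B = m+1], [C = m-2], both [A - (m-1) B + m C] and
    [A^3 - (m-1) B^3 + m C^3] vanish, so the first nonzero Taylor coefficient at [0]
    has order five.  Applying [D^2 - C^2] removes the last term, and
    [A (A^2 - C^2) = (m-1) B (B^2 - C^2)] turns what is left into a positive multiple
    of [B sinh(A v) - A sinh(B v)].  The operator is then inverted one factor at a
    time, with integrating factors [e^(-C v)] and [e^(C v)]. *)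
Lemma sinh_three_term_pos (m u : R) :
  2 < m -> 0 < u ->
  0 < sinh ((2 * m - 1) * u) - (m - 1) * sinh ((m + 1) * u)
      + m * sinh ((m - 2) * u).
Proof.
intros Hm Hu.
set (A := 2 * m - 1). set (B := m + 1). set (C := m - 2).
set (G := fun v => sinh (A * v) - (m - 1) * sinh (B * v) + m * sinh (C * v)).
set (G1 := fun v => A * cosh (A * v) - (m - 1) * B * cosh (B * v)
                    + m * C * cosh (C * v)).
assert (HV : forall v, 0 < v -> 0 < (G1 v + C * G v) * exp (- (C * v))).
{ apply (pos_of_deriv_pos _ (fun v =>
     (A ^ 2 - C ^ 2) * / B * (B * sinh (A * v) - A * sinh (B * v))
     * exp (- (C * v)))).
  - unfold G1, G. rewrite !Rmult_0_r, sinh_0, cosh_0. unfold A, B, C. ring.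
  - intros v. unfold G1, G. auto_derive; [easy|].
    unfold A, B, C. field. lra.
  - intros v Hv. apply Rmult_lt_0_compat; [|apply exp_pos].
    apply Rmult_lt_0_compat.
    + apply Rmult_lt_0_compat; [unfold A, C; nra|].
      apply Rinv_0_lt_compat. unfold B; lra.
    + pose proof (sinh_ratio_lt A B v ltac:(unfold A, B; lra) Hv). lra. }
assert (HG : 0 < G u * exp (C * u)).
{ revert u Hu. apply (pos_of_deriv_pos _ (fun v => (G1 v + C * G v) * exp (C * v))).
  - unfold G. rewrite !Rmult_0_r, sinh_0. ring.
  - intros v. unfold G1, G. auto_derive; [easy|ring].
  - intros v Hv. apply Rmult_lt_0_compat; [|apply exp_pos].
    apply (Rmult_lt_reg_r (exp (- (C * v)))); [apply exp_pos|].
    rewrite Rmult_0_l. now apply HV. }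
apply (Rmult_lt_reg_r (exp (C * u))); [apply exp_pos|].
rewrite Rmult_0_l. exact HG.
Qed.

(** * Exponential power sums *)

Lemma exp_nondecr (x y : R) : x <= y -> exp x <= exp y.
Proof.
intros [H|H]; [left; now apply exp_increasing|right; now rewrite H].
Qed.

(** The exponent [k] makes the family closed under differentiation in [t]:
    [f] is built from [k = 0], the critical equation from [k = 1], and the slope of
    [logratio] at [0] from [k = 2]. *)
Definition expsum (k N : nat) (t : R) : R :=
  sum_n_m (fun i => INR i ^ k * exp (INR i * t)) 1 N.

Lemma expsum_S (k N : nat) (t : R) :
  expsum k (S N) t = expsum k N t + INR (S N) ^ k * exp (INR (S N) * t).
Proof. unfold expsum. now rewrite sum_n_Sm by lia. Qed.

Lemma expsum_0 (k : nat) (t : R) : expsum k 0 t = 0.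
Proof. unfold expsum. now rewrite sum_n_m_zero by lia. Qed.

Lemma is_derive_expsum (k N : nat) (t : R) :
  is_derive (expsum k N) t (expsum (S k) N t).
Proof.
induction N as [|N IH].
- rewrite expsum_0. apply is_derive_ext with (fun _ => 0).
  + intros x. now rewrite expsum_0.
  + apply (is_derive_const (V := R_NormedModule)).
- rewrite expsum_S.
  apply is_derive_ext with
    (fun x => plus (expsum k N x) (INR (S N) ^ k * exp (INR (S N) * x))).
  + intros x. now rewrite expsum_S.
  + apply (is_derive_plus (V := R_NormedModule)); [exact IH|].
    generalize (INR (S N)). intros r. auto_derive; [easy|]. simpl pow. ring.
Qed.

Lemma expsum_ge_first (k N : nat) (t : R) : (1 <= N)%nat -> exp t <= expsum k N t.
Proof.
intros HN. induction HN as [|N HN IH].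
- rewrite expsum_S, expsum_0. simpl INR. rewrite pow1, Rmult_1_l.
  rewrite Rmult_1_l. lra.
- rewrite expsum_S.
  assert (0 < INR (S N) ^ k * exp (INR (S N) * t)); [|lra].
  apply Rmult_lt_0_compat; [|apply exp_pos].
  apply pow_lt, lt_0_INR. lia.
Qed.

Lemma expsum_pos (k N : nat) (t : R) : (1 <= N)%nat -> 0 < expsum k N t.
Proof.
intros HN. pose proof (expsum_ge_first k N t HN). pose proof (exp_pos t). lra.
Qed.

Lemma expsum_incr (k N : nat) (s t : R) : s <= t -> expsum k N s <= expsum k N t.
Proof.
intros Hst. apply sum_n_m_le. intros i.
apply Rmult_le_compat_l; [apply pow_le, pos_INR|].
apply exp_nondecr, Rmult_le_compat_l; [apply pos_INR|exact Hst].
Qed.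

Lemma expsum_le_last (k N : nat) (t : R) :
  0 <= t -> expsum k N t <= expsum k N 0 * exp (INR N * t).
Proof.
intros Ht. induction N as [|N IH].
- rewrite !expsum_0. lra.
- rewrite !expsum_S, Rmult_plus_distr_r, Rmult_0_r, exp_0, Rmult_1_r.
  apply Rplus_le_compat_r. apply Rle_trans with (1 := IH).
  apply Rmult_le_compat_l.
  + apply sum_n_m_ge0. intros i. apply Rmult_le_pos.
    * apply pow_le, pos_INR.
    * left. apply exp_pos.
  + apply exp_nondecr, Rmult_le_compat_r; [exact Ht|]. rewrite S_INR. lra.
Qed.

(** The factor [e^t - 2 + e^-t = (e^t - 1)^2 / e^t] is the usual [(x - 1)^2] of the
    sum of the [i x^i], normalized to be even in [t] so that the formula may be used
    at [t] and at [- t] with the same factor. *)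
Lemma expsum_closed (N : nat) (t : R) :
  (exp t - 2 + exp (- t)) * expsum 1 N t =
  1 - INR (S N) * exp (INR N * t) + INR N * exp (INR (S N) * t).
Proof.
induction N as [|N IH].
- rewrite expsum_0. simpl INR. rewrite Rmult_0_l, exp_0. ring.
- rewrite expsum_S, Rmult_plus_distr_l, IH, (S_INR (S N)), (S_INR N).
  replace (INR N * t) with ((INR N + 1) * t + - t) by ring.
  replace ((INR N + 1 + 1) * t) with ((INR N + 1) * t + t) by ring.
  rewrite !exp_plus, exp_Ropp.
  pose proof (exp_pos t). field. lra.
Qed.

Lemma expsum_at_0 (N : nat) :
  expsum 1 N 0 = INR N * (INR N + 1) / 2 /\
  expsum 2 N 0 = INR N * (INR N + 1) * (2 * INR N + 1) / 6.
Proof.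
induction N as [|N [IH1 IH2]].
- rewrite !expsum_0. simpl INR. split; field.
- rewrite !expsum_S, IH1, IH2, S_INR, Rmult_0_r, exp_0. split; field.
Qed.

Lemma kernel_pos (t : R) : 0 < t -> 0 < exp t - 2 + exp (- t).
Proof.
intros Ht. pose proof (exp_increasing 0 t Ht) as H. rewrite exp_0 in H.
rewrite exp_Ropp.
replace (exp t - 2 + / exp t) with ((exp t - 1) ^ 2 * / exp t) by (field; lra).
apply Rmult_lt_0_compat; [apply pow_lt; lra|apply Rinv_0_lt_compat; lra].
Qed.

(** The lower bound [L(t) > n t] before taking logarithms.  Multiplied by the even
    factor of the closed form, the difference of the two sides is [2 e^(n t/2)] times
    [(n-2) sinh(n t/2) - n sinh((n-2) t/2)]. *)
Lemma expsum_ratio_gt (n : nat) (t : R) :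
  (3 <= n)%nat -> 0 < t ->
  exp (INR n * t) * expsum 1 (n - 1) (- t) < expsum 1 (n - 1) t.
Proof.
intros Hn Ht.
apply (Rmult_lt_reg_l _ _ _ (kernel_pos t Ht)).
pose proof (expsum_closed (n - 1) t) as E1.
pose proof (expsum_closed (n - 1) (- t)) as E2.
rewrite Ropp_involutive in E2.
replace (S (n - 1)) with n in * by lia.
rewrite minus_INR in E1, E2 by lia. simpl (INR 1) in *.
apply le_INR in Hn. simpl (INR 3) in Hn.
set (m := INR n) in *.
rewrite E1.
replace ((exp t - 2 + exp (- t)) * (exp (m * t) * expsum 1 (n - 1) (- t)))
  with (exp (m * t) * ((exp (- t) - 2 + exp t) * expsum 1 (n - 1) (- t))) by ring.
rewrite E2.
pose proof (sinh_ratio_lt m (m - 2) (t / 2) ltac:(lra) ltac:(lra)) as H.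
unfold sinh in H. rewrite !exp_Ropp in H.
rewrite !Ropp_mult_distr_r_reverse, !exp_Ropp.
replace (m * t) with (m * (t / 2) + m * (t / 2)) by field.
replace ((m - 1) * t) with (m * (t / 2) + (m - 2) * (t / 2)) by field.
rewrite !exp_plus.
pose proof (exp_pos (m * (t / 2))). pose proof (exp_pos ((m - 2) * (t / 2))).
set (p := exp (m * (t / 2))) in *. set (q := exp ((m - 2) * (t / 2))) in *.
apply Rminus_lt_0.
match goal with |- 0 < ?x => replace x
  with (p * (2 * ((m - 2) * ((p - / p) / 2) - m * ((q - / q) / 2))))
  by (field; lra) end.
apply Rmult_lt_0_compat; lra.
Qed.

(** The upper bound [L(t) < (4n-2)/3 t] before taking logarithms.  Multiplied by the
    even factor of the closed form, the difference of the two sides is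
    [2 e^((2n-1) t/3)] times the three-term combination of [sinh_three_term_pos] at
    [u = t/3]. *)
Lemma expsum_ratio_lt (n : nat) (t : R) :
  (3 <= n)%nat -> 0 < t ->
  expsum 1 (n - 1) t
  < exp ((4 * INR n - 2) / 3 * t) * expsum 1 (n - 1) (- t).
Proof.
intros Hn Ht.
apply (Rmult_lt_reg_l _ _ _ (kernel_pos t Ht)).
pose proof (expsum_closed (n - 1) t) as E1.
pose proof (expsum_closed (n - 1) (- t)) as E2.
rewrite Ropp_involutive in E2.
replace (S (n - 1)) with n in * by lia.
rewrite minus_INR in E1, E2 by lia. simpl (INR 1) in *.
apply le_INR in Hn. simpl (INR 3) in Hn.
set (m := INR n) in *.
rewrite E1.
replace ((exp t - 2 + exp (- t)) * (exp ((4 * m - 2) / 3 * t) * expsum 1 (n - 1) (- t)))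
  with (exp ((4 * m - 2) / 3 * t)
        * ((exp (- t) - 2 + exp t) * expsum 1 (n - 1) (- t))) by ring.
rewrite E2.
pose proof (sinh_three_term_pos m (t / 3) ltac:(lra) ltac:(lra)) as H.
unfold sinh in H. rewrite !exp_Ropp in H.
rewrite !Ropp_mult_distr_r_reverse, !exp_Ropp.
replace ((4 * m - 2) / 3 * t)
  with ((2 * m - 1) * (t / 3) + (2 * m - 1) * (t / 3)) by field.
replace (m * t) with ((2 * m - 1) * (t / 3) + (m + 1) * (t / 3)) by field.
replace ((m - 1) * t) with ((2 * m - 1) * (t / 3) + (m - 2) * (t / 3)) by field.
rewrite !exp_plus.
pose proof (exp_pos ((2 * m - 1) * (t / 3))).
pose proof (exp_pos ((m + 1) * (t / 3))). pose proof (exp_pos ((m - 2) * (t / 3))).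
set (a := exp ((2 * m - 1) * (t / 3))) in *.
set (b := exp ((m + 1) * (t / 3))) in *. set (c := exp ((m - 2) * (t / 3))) in *.
apply Rminus_lt_0.
match goal with |- 0 < ?x => replace x
  with (a * (2 * ((a - / a) / 2 - (m - 1) * ((b - / b) / 2) + m * ((c - / c) / 2))))
  by (field; lra) end.
apply Rmult_lt_0_compat; lra.
Qed.

(** * The critical equation *)

(** By the critical equation, this is [ln gamma] as an explicit function of
    [t = 2 ln rho0]: the inverse function of the one under study. *)
Definition logratio (N : nat) (t : R) : R :=
  ln (expsum 1 N t) - ln (expsum 1 N (- t)).

(** The change of variable [rho = e^(t/2)] makes [f] a combination of exponential
    sums, whose derivatives stay in the same family. *)
Lemma f_exp (gamma : R) (n : nat) (t : R) :
  Defs.f gamma 1 n (exp (t / 2)) =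
  gamma + 1 + (gamma * expsum 0 (n - 1) (- t) + expsum 0 (n - 1) t).
Proof.
unfold Defs.f, expsum. f_equal.
change (gamma * sum_n_m ?u ?a ?b) with (mult gamma (sum_n_m u a b)).
rewrite <- (sum_n_m_mult_l (K := R_Ring)).
change (?x + sum_n_m ?u ?a ?b) with (plus x (sum_n_m u a b)).
rewrite <- (sum_n_m_plus (G := R_AbelianMonoid)).
apply sum_n_m_ext. intros i.
change (gamma / exp (t / 2) ^ (2 * i) + 1 * exp (t / 2) ^ (2 * i) =
  gamma * (1 * exp (INR i * - t)) + 1 * exp (INR i * t)).
assert (E : exp (t / 2) ^ (2 * i) = exp (INR i * t)).
{ rewrite <- Rpower_pow by apply exp_pos. unfold Rpower.
  rewrite ln_exp, mult_INR. f_equal. simpl (INR 2). field. }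
rewrite E, Ropp_mult_distr_r_reverse, exp_Ropp.
field. apply Rgt_not_eq, exp_pos.
Qed.

Lemma rho0_is_minimizer (gamma : R) (n : nat) :
  0 < gamma -> (2 <= n)%nat -> is_minimizer_pos (Defs.f gamma 1 n) (rho0 gamma n).
Proof.
intros Hg Hn. replace gamma with (gamma / 1) at 2 by field.
apply rho0_minimizes; auto; lra.
Qed.

(** Fermat's criterion in the variable [t], where the minimum over [rho > 0] becomes
    a minimum over the whole line. *)
Lemma rho0_critical (gamma : R) (n : nat) :
  0 < gamma -> (2 <= n)%nat ->
  expsum 1 (n - 1) (2 * ln (rho0 gamma n)) =
  gamma * expsum 1 (n - 1) (- (2 * ln (rho0 gamma n))).
Proof.
intros Hg Hn. destruct (rho0_is_minimizer gamma n Hg Hn) as [Hr Hmin].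
set (t := 2 * ln (rho0 gamma n)).
set (N := (n - 1)%nat).
set (phi := fun t => gamma + 1 + (gamma * expsum 0 N (- t) + expsum 0 N t)).
assert (Et : exp (t / 2) = rho0 gamma n).
{ unfold t. replace (2 * ln (rho0 gamma n) / 2) with (ln (rho0 gamma n)) by field.
  now apply exp_ln. }
assert (Hd : derivable_pt_lim phi t (expsum 1 N t - gamma * expsum 1 N (- t))).
{ apply is_derive_Reals. unfold phi.
  pose proof (is_derive_expsum 0 N) as HD.
  auto_derive.
  - split; [eexists; apply HD|]. split; [eexists; apply HD|easy].
  - rewrite !(is_derive_unique _ _ _ (HD _)). ring. }
assert (Hz : derive_pt phi t (exist _ _ Hd) = 0).
{ apply (deriv_minimum phi (t - 1) (t + 1)); try lra.
  intros x _ _. unfold phi, N. rewrite <- !f_exp, Et.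
  apply Hmin, exp_pos. }
simpl in Hz. lra.
Qed.

(** If [t <= 0] then [a(t) <= a(-t)], and the critical equation gives [gamma <= 1]. *)
Lemma ln_rho0_pos (gamma : R) (n : nat) :
  1 < gamma -> (2 <= n)%nat -> 0 < ln (rho0 gamma n).
Proof.
intros Hg Hn. apply Rnot_le_lt. intros Hle.
pose proof (rho0_critical gamma n ltac:(lra) Hn) as H.
set (t := 2 * ln (rho0 gamma n)) in *.
pose proof (expsum_incr 1 (n - 1) t (- t) ltac:(unfold t; lra)).
pose proof (expsum_pos 1 (n - 1) (- t) ltac:(lia)).
nra.
Qed.

Lemma ln_gamma_eq (gamma : R) (n : nat) :
  0 < gamma -> (2 <= n)%nat -> ln gamma = logratio (n - 1) (2 * ln (rho0 gamma n)).
Proof.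
intros Hg Hn. unfold logratio. rewrite rho0_critical by assumption.
rewrite ln_mult; [ring|assumption|]. apply expsum_pos. lia.
Qed.

Lemma logratio_bounds (n : nat) (t : R) :
  (3 <= n)%nat -> 0 < t ->
  INR n * t < logratio (n - 1) t < (4 * INR n - 2) / 3 * t.
Proof.
intros Hn Ht.
pose proof (expsum_pos 1 (n - 1) t ltac:(lia)) as P1.
pose proof (expsum_pos 1 (n - 1) (- t) ltac:(lia)) as P2.
pose proof (expsum_ratio_gt n t Hn Ht) as H1.
pose proof (expsum_ratio_lt n t Hn Ht) as H2.
apply ln_increasing in H1; [|apply Rmult_lt_0_compat; [apply exp_pos|assumption]].
apply ln_increasing in H2; [|assumption].
rewrite ln_mult, ln_exp in H1 by (try apply exp_pos; assumption).
rewrite ln_mult, ln_exp in H2 by (try apply exp_pos; assumption).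
unfold logratio. lra.
Qed.

(** Only the dominant terms matter for large [t]: [a(t)] is at most
    [a(0) e^((n-1) t)], and [a(-t)] is at least its first term [e^-t]. *)
Lemma logratio_upper_affine (n : nat) (t : R) :
  (2 <= n)%nat -> 0 <= t ->
  logratio (n - 1) t <= INR n * t + ln (expsum 1 (n - 1) 0).
Proof.
intros Hn Ht. unfold logratio.
pose proof (expsum_pos 1 (n - 1) t ltac:(lia)) as P.
pose proof (ln_le _ _ P (expsum_le_last 1 (n - 1) t Ht)) as H1.
pose proof (ln_le _ _ (exp_pos _) (expsum_ge_first 1 (n - 1) (- t) ltac:(lia))) as H2.
rewrite ln_mult, ln_exp in H1 by (try apply exp_pos; apply expsum_pos; lia).
rewrite ln_exp in H2. rewrite minus_INR in H1 by lia. simpl (INR 1) in H1. lra.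
Qed.

(** The slope is [2 a'(0) / a(0)], twice the sum of the squares up to [n - 1]
    divided by the sum of the integers up to [n - 1]. *)
Lemma is_derive_logratio_0 (n : nat) :
  (2 <= n)%nat -> is_derive (logratio (n - 1)) 0 ((4 * INR n - 2) / 3).
Proof.
intros Hn. unfold logratio.
pose proof (expsum_pos 1 (n - 1) 0 ltac:(lia)) as P.
pose proof (is_derive_expsum 1 (n - 1)) as HD.
auto_derive.
- rewrite Ropp_0. repeat split; trivial; eexists; apply HD.
- rewrite !(is_derive_unique _ _ _ (HD _)), Ropp_0.
  destruct (expsum_at_0 (n - 1)) as [E1 E2]. rewrite E1, E2.
  apply le_INR in Hn as Hn'. simpl (INR 2) in Hn'.
  rewrite minus_INR by lia. simpl (INR 1). field. lra.
Qed.

(** * Asymptotics *)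

Lemma rho0_ln_bounds (gamma : R) (n : nat) :
  (3 <= n)%nat -> 1 < gamma ->
  3 / (8 * INR n - 4) * ln gamma < ln (rho0 gamma n) < 1 / (2 * INR n) * ln gamma.
Proof.
intros Hn Hg.
pose proof (ln_rho0_pos gamma n Hg ltac:(lia)) as Hl.
pose proof (logratio_bounds n (2 * ln (rho0 gamma n)) Hn ltac:(lra)) as H.
rewrite <- ln_gamma_eq in H by (lra || lia).
apply le_INR in Hn. simpl (INR 3) in Hn.
split.
- apply (Rmult_lt_reg_l ((8 * INR n - 4) / 3)); [lra|].
  replace ((8 * INR n - 4) / 3 * (3 / (8 * INR n - 4) * ln gamma))
    with (ln gamma) by (field; lra). lra.
- apply (Rmult_lt_reg_l (2 * INR n)); [lra|].
  replace (2 * INR n * (1 / (2 * INR n) * ln gamma))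
    with (ln gamma) by (field; lra). lra.
Qed.

Lemma ln_gt_0 (x : R) : 1 < x -> 0 < ln x.
Proof. intros Hx. rewrite <- ln_1. apply ln_increasing; lra. Qed.

(** The limit is taken in the punctured neighbourhoods of [0], as needed to compose
    with a difference quotient at [0]. *)
Lemma ln_rho0_tends_0 (n : nat) :
  (3 <= n)%nat ->
  filterlim (fun gamma => 2 * ln (rho0 gamma n)) (at_right 1) (locally' 0).
Proof.
intros Hn.
assert (L : filterlim (fun gamma => 2 * ln (rho0 gamma n)) (at_right 1) (locally 0)).
{ apply (filterlim_le_le (fun _ => 0) _ (fun gamma => 2 * (1 / (2 * INR n)) * ln gamma)
    (Finite 0)).
  - exists posreal_one. intros gamma _ Hg.
    pose proof (ln_rho0_pos gamma n Hg ltac:(lia)).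
    pose proof (rho0_ln_bounds gamma n Hn Hg). lra.
  - apply filterlim_const.
  - apply (filterlim_filter_le_1 (F := locally 1)); [apply filter_le_within|].
    replace (Finite 0) with (Finite (2 * (1 / (2 * INR n)) * ln 1))
      by (rewrite ln_1; f_equal; ring).
    apply (ex_derive_continuous (V := R_NormedModule)
      (fun gamma => 2 * (1 / (2 * INR n)) * ln gamma)).
    auto_derive. lra. }
intros P HP. specialize (L _ HP). unfold filtermap in *.
destruct L as [d Hd]. exists d. intros gamma Hgd Hg.
apply (Hd gamma Hgd Hg). pose proof (ln_rho0_pos gamma n Hg ltac:(lia)). lra.
Qed.

(** As [L(0) = 0], the quotient [L(t) / t] is the difference quotient of [L] at [0]. *)
Lemma logratio_quotient_lim (n : nat) :
  (2 <= n)%nat ->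
  filterlim (fun t => logratio (n - 1) t / t) (locally' 0)
    (locally ((4 * INR n - 2) / 3)).
Proof.
intros Hn. apply filterlim_locally. intros eps.
pose proof (is_derive_logratio_0 n Hn) as HD. apply is_derive_Reals in HD.
destruct (HD eps (cond_pos eps)) as [d Hd].
exists d. intros t Ht Ht0. change (Rabs (t - 0) < d) in Ht.
rewrite Rminus_0_r in Ht. specialize (Hd t Ht0 Ht).
change (Rabs (logratio (n - 1) t / t - (4 * INR n - 2) / 3) < eps).
rewrite Rplus_0_l in Hd. replace (logratio (n - 1) 0) with 0 in Hd
  by (unfold logratio; rewrite Ropp_0; ring).
now rewrite Rminus_0_r in Hd.
Qed.

Theorem theorem1p3 (n : nat) (hn : (3 <= n)%nat) :
  (forall gamma : R, 1 < gamma ->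
     Rpower gamma (3 / (8 * INR n - 4)) < rho0 gamma n
     /\ rho0 gamma n < Rpower gamma (1 / (2 * INR n)))
  /\ filterlim (fun gamma : R => ln (rho0 gamma n) / ln gamma)
       (at_right 1) (locally (3 / (8 * INR n - 4)))
  /\ is_lim (fun gamma : R => ln (rho0 gamma n) / ln gamma)
       p_infty (1 / (2 * INR n)).
Proof.
assert (Hn : 3 <= INR n) by (apply le_INR in hn; simpl (INR 3) in hn; lra).
split; [|split].
- intros gamma Hg. destruct (rho0_ln_bounds gamma n hn Hg) as [H1 H2].
  destruct (rho0_is_minimizer gamma n ltac:(lra) ltac:(lia)) as [Hr _].
  rewrite <- (exp_ln _ Hr). unfold Rpower.
  split; now apply exp_increasing.
- apply (filterlim_ext_loc (fun gamma =>
    / (2 * (logratio (n - 1) (2 * ln (rho0 gamma n)) / (2 * ln (rho0 gamma n)))))).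
  + exists posreal_one. intros gamma _ Hg.
    pose proof (ln_rho0_pos gamma n Hg ltac:(lia)).
    pose proof (ln_gt_0 gamma Hg).
    rewrite <- ln_gamma_eq by (lra || lia). field. lra.
  + apply (filterlim_comp _ _ _ (fun gamma => 2 * ln (rho0 gamma n))
      (fun t => / (2 * (logratio (n - 1) t / t))) _ (locally' 0));
      [now apply ln_rho0_tends_0|].
    apply (filterlim_comp _ _ _ (fun t => logratio (n - 1) t / t)
      (fun y => / (2 * y)) _ (locally ((4 * INR n - 2) / 3)));
      [apply logratio_quotient_lim; lia|].
    replace (3 / (8 * INR n - 4)) with (/ (2 * ((4 * INR n - 2) / 3)))
      by (field; lra).
    apply (ex_derive_continuous (V := R_NormedModule) (fun y => / (2 * y))).
    auto_derive. lra.
- apply (is_lim_le_le_loc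
    (fun gamma => 1 / (2 * INR n)
       - ln (expsum 1 (n - 1) 0) / (2 * INR n) * / ln gamma)
    (fun _ => 1 / (2 * INR n))).
  + exists 1. intros gamma Hg. pose proof (ln_gt_0 gamma Hg) as Hl.
    pose proof (rho0_ln_bounds gamma n hn Hg) as [_ H2].
    pose proof (ln_rho0_pos gamma n Hg ltac:(lia)) as H0.
    pose proof (logratio_upper_affine n (2 * ln (rho0 gamma n)) ltac:(lia) ltac:(lra))
      as H1.
    rewrite <- ln_gamma_eq in H1 by (lra || lia).
    split; apply (Rmult_le_reg_r (ln gamma)); try exact Hl;
      unfold Rdiv at 1; rewrite ?(Rmult_assoc _ (/ ln gamma)), ?Rinv_l by lra.
    * apply (Rmult_le_reg_l (2 * INR n)); [lra|].
      match goal with |- ?x <= _ => replace x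
        with (ln gamma - ln (expsum 1 (n - 1) 0)) by (field; lra) end.
      replace (2 * INR n * (ln (rho0 gamma n) / ln gamma * ln gamma))
        with (INR n * (2 * ln (rho0 gamma n))) by (field; lra). lra.
    * lra.
  + replace (Finite (1 / (2 * INR n)))
      with (Finite (1 / (2 * INR n) - ln (expsum 1 (n - 1) 0) / (2 * INR n) * 0))
      by (f_equal; ring).
    apply is_lim_minus'; [apply is_lim_const|].
    apply (is_lim_scal_l (fun gamma => / ln gamma) _ p_infty (Finite 0)).
    apply (is_lim_inv _ p_infty p_infty is_lim_ln_p). discriminate.
  + apply is_lim_const.
Qed.
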